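(* Let $\boldsymbol\nu=(\nu,\lambda,\rho,\nu^\infty)\in\mathbf Y^2(\Omega;E)$ be an $\mathcal A$-free two-scale* Young measure and let $h\in C(Z\times E)\cap\mathbf R^2(\Omega;E)$ be an integrand that is convex in its second argument, that is, $h(\xi,\cdot)$ is convex for all $\xi\in Z$. Then, for all regular points $x\in\mathrm{Reg}_{\boldsymbol\nu}(\overline\Omega)$ the following inequalities hold: (i) at $\mathscr L^d_Z$-almost every $\xi$ in $Z$, $$h\Big(\xi,\frac{d[\![\boldsymbol\nu]\!]_x}{d\mathscr L^d}(\xi)\Big)\le\frac{d[\![h,\boldsymbol\nu]\!]_x}{d\mathscr L^d}(\xi);$$ (ii) and, at $\rho_x^s$-almost every $\xi$ in $Z$, $$h^\infty\Big(\xi,\frac{d[\![\boldsymbol\nu]\!]_x}{d\rho_x^s}(\xi)\Big)\le\frac{d[\![h^\infty,\boldsymbol\nu]\!]_x}{d\rho_x^s}(\xi).$$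
   Context: $\Omega\subset\mathbb R^d$ is open and bounded with $\mathscr L^d(\partial\Omega)=0$; $Z=\mathbb T^d=\mathbb R^d/\mathbb Z^d$ with Lebesgue measure $\mathscr L^d_Z$ (also written $d\xi$); $E,F$ are finite-dimensional Euclidean spaces; $\mathbb B_E$ is the open unit ball of $E$. $\mathcal A=\sum_{|\alpha|=k}A_\alpha\partial^\alpha$, $A_\alpha\in\mathrm{Lin}(E;F)$, is a homogeneous constant-coefficient operator of order $k$ on $\mathbb R^d$. $\langle g,\sigma\rangle=\int g\,d\sigma$. A two-scale* Young measure is a four-tuple $\boldsymbol\nu=(\nu,\lambda,\rho,\nu^\infty)$ where: (i) $(x,\xi)\mapsto\nu_{x,\xi}$ is a weak-* measurable (w.r.t. Lebesgue measure) map from $\overline\Omega\times Z$ to $\mathrm{Prob}(E)$ with $(x,\xi)\mapsto\int_E|z|\,d\nu_{x,\xi}(z)$ integrable; (ii) $\lambda$ is a bounded positive measure on $\overline\Omega$, with Lebesgue decomposition $\lambda=\lambda^{ac}\mathscr L^d+\lambda^s$; (iii) $x\mapsto\rho_x$ is a weak-* $\lambda$-measurable map from $\overline\Omega$ to $\mathrm{Prob}(Z)$; (iv) $(x,\xi)\mapsto\nu^\infty_{x,\xi}$ is a weak-* $(\lambda\otimes\rho_x)$-measurable map to $\mathrm{Prob}(\partial\mathbb B_E)$. The set of these is $\mathbf Y^2(\Omega;E)$. Generation: $\mathbf E^2(\Omega;E)$ is the set of $f\in C(\Omega\times Z\times E)$ such that $(Tf)(x,\xi,\hat z)=(1-|\hat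 z|)f(x,\xi,\hat z/(1-|\hat z|))$ extends continuously to $\overline{\Omega\times Z\times\mathbb B_E}$; then the strong recession function $f^\infty(x,\xi,z)=\lim_{x'\to x,\xi'\to\xi,t\to\infty}f(x',\xi',tz)/t$ exists. $(\mu_\varepsilon)\subset\mathcal M(\Omega;E)$, $\varepsilon\searrow0$, generates $\boldsymbol\nu$ if for all $f\in\mathbf E^2(\Omega;E)$ $$\int_\Omega f(x,x/\varepsilon,\mu_\varepsilon^{ac})\,dx+\int_\Omega f^\infty(x,x/\varepsilon,(\mu_\varepsilon)_s)\,d|\mu_\varepsilon^s|\to\int_\Omega\int_Z\langle f(x,\xi,\cdot),\nu_{x,\xi}\rangle\,d\xi\,dx+\int_{\overline\Omega}\int_Z\langle f^\infty(x,\xi,\cdot),\nu^\infty_{x,\xi}\rangle\,d\rho_x(\xi)\,d\lambda(x),$$ where $\mu=\mu^{ac}\mathscr L^d+\mu_s|\mu^s|$ is the Radon–Nikodým–Lebesgue decomposition. $\boldsymbol\nu$ is $\mathcal A$-free (for a fixed $1<p<\frac d{d-1}$) if there are $\varepsilon\searrow0$ and $(\mu_\varepsilon)\subset\mathcal M(\Omega;E)$ generating $\boldsymbol\nu$ with $\mathcal A\mu_\varepsilon\to0$ strongly in $W^{-k,p}(\Omega)$. $\mathbf R^2(\Omega;E)$ is the class of $f\in C(\Omega\times Z\times E)$ possessing a strong recession function, i.e. with $f^\infty\equiv f^\#\equiv f_\#$, where $f^\#$ and $f_\#$ are the limsup and liminf of $f(x',\xi',tz)/t$ as $x'\to x$,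 $\xi'\to\xi$, $t\to\infty$. Functions $h\in C(Z\times E)$ are regarded as integrands independent of $x$. Regular points: the Radon–Nikodym decomposition of $\lambda$ gives a partition of $\overline\Omega$ into a set of regular points $\mathrm{Reg}_{\boldsymbol\nu}(\overline\Omega)$ and a set of singular points $\mathrm{Sing}_{\boldsymbol\nu}=\{x\in\overline\Omega:\frac{d\mathscr L^d}{d|\lambda^s|}(x)=0\}$, with $\mathscr L^d(\mathrm{Sing}_{\boldsymbol\nu})=\lambda^s(\mathrm{Reg}_{\boldsymbol\nu}(\overline\Omega))=0$. Second-scale barycenters at regular points $x$: for Borel $V\subset Z$, $$[\![\boldsymbol\nu]\!]_x(V)=\int_V\langle\mathrm{id}_E,\nu_{x,\xi}\rangle d\xi+\lambda^{ac}(x)\int_V\langle\mathrm{id}_{\partial\mathbb B_E},\nu^\infty_{x,\xi}\rangle d\rho_x(\xi),$$ $$[\![g,\boldsymbol\nu]\!]_x(V)=\int_V\langle g(\xi,\cdot),\nu_{x,\xi}\rangle d\xi+\lambda^{ac}(x)\int_V\langle g^\infty(\xi,\cdot),\nu^\infty_{x,\xi}\rangle d\rho_x(\xi)\qquad(g=h\text{ or }g=h^\infty).$$ $\rho_x^s$ is the part of $\rho_x$ singular with respect to Lebesgue measure on $Z$; $\frac{d\,\cdot}{d\mathscr L^d}$ and $\frac{d\,\cdot}{d\rho_x^s}$ denote Radon–Nikodym densities. *)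

(* Defs.v *)
From HB Require Import structures.
From mathcomp Require Import all_boot all_order all_algebra.
From mathcomp Require Import generic_quotient.
From mathcomp Require Import all_classical all_reals all_analysis.
From mathcomp Require Import measurable_realfun.
Set Implicit Arguments. Unset Strict Implicit. Unset Printing Implicit Defensive.
Import Order.TTheory GRing.Theory Num.Theory.
Import numFieldNormedType.Exports.
Local Open Scope classical_set_scope.
Local Open Scope ring_scope.

(* Borel sigma-algebra *)
HB.instance Definition _ (R : realType) (m n : nat) :=
  @isMeasurable.Build (sigma_display (@open 'M[R]_(m, n))) 'M[R]_(m, n)
    <<s @open 'M[R]_(m, n) >> (@sigma_algebra0 _ setT _)
    (@sigma_algebraC _ _) (@sigma_algebra_bigcup _ setT _).

Lemma pushforward_additive d1 d2 (T1 : measurableType d1)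
    (T2 : measurableType d2) (R : realType) (mu : {measure set T1 -> \bar R})
    (f : T1 -> T2) :
  measurable_fun setT f -> semi_sigma_additive (pushforward mu f).
Proof.
move=> mf F mF tF mUF.
have mc A : measurable A -> measurable (f @^-1` A).
  by move=> mA; rewrite -[X in measurable X]setTI; exact: mf.
rewrite /pushforward preimage_bigcup.
apply: measure_semi_sigma_additive => [i||]; first exact: mc.
  apply/trivIsetP => /= i j _ _ ij; rewrite -preimage_setI.
  by move/trivIsetP : tF => /(_ _ _ _ _ ij) ->//; rewrite preimage_set0.
by rewrite -preimage_bigcup; exact: mc.
Qed.

Section lebesgue_rV.
Variable R : realType.

Lemma measurable_coord m n i j :
  measurable_fun setT (fun M : 'M[R]_(m, n) => M i j : R).
Proof.
apply: (measurability _ (RGenOpens.measurableE R)) => _ [_ [a [b ->] <-]].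
rewrite setTI; apply: sub_sigma_algebra.
apply: open_comp; last exact: interval_open.
by move=> M _; exact: coord_continuous.
Qed.

Definition cons_rV n (p : R * 'rV[R]_n) : 'rV[R]_n.+1 :=
  \row_i (if unlift ord0 i is Some j then p.2 0 j else p.1).

Lemma measurable_to_rV d (T : measurableType d) n (f : T -> 'rV[R]_n) :
  (forall i, measurable_fun setT (fun t => f t 0 i)) -> measurable_fun setT f.
Proof.
move=> mf; apply: (@measurability _ _ _ _ _ _ (@open 'rV[R]_n)) => //.
move=> _ [U oU <-]; rewrite setTI.
pose box (qk : 'rV[rat]_n * nat) : set 'rV[R]_n :=
  [set v | forall i, `|v 0 i - ratr (qk.1 0 i)| < qk.2.+1%:R^-1].
have mbox qk : measurable (f @^-1` box qk).
  rewrite (_ : _ @^-1` _ =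
    \bigcap_(i in [set: 'I_n]) ((fun t => f t 0 i) @^-1`
      ball (ratr (qk.1 0 i) : R) qk.2.+1%:R^-1)); last first.
    apply/seteqP; split=> [t bt i _|t bt i] /=.
      by rewrite /ball /= distrC; exact: bt.
    by have := bt i Logic.I; rewrite /= /ball /= distrC.
  apply: fin_bigcap_measurable => [|i _]; first exact: finite_finset.
  rewrite -[X in measurable X]setTI; apply: mf => //.
  by apply: open_measurable; exact: ball_open.
rewrite (_ : f @^-1` U = \bigcup_qk
    (if pselect (box qk `<=` U) then f @^-1` box qk else set0)); last first.
  apply/seteqP; split=> [t Uft|t [qk _]]; last first.
    by case: pselect => // bU /bU.
  have : nbhs (f t) U by exact: open_nbhs_nbhs.
  move=> /nbhs_ballP[e /= e0 eU].
  have [k ke] : exists k : nat, k.+1%:R^-1 < e / 2.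
    exists (Num.truncn (e / 2)^-1).
    rewrite invf_plt ?posrE ?divr_gt0 //.
    by rewrite truncnS_gt.
  have q_ i : {q : rat | `|f t 0 i - ratr q| < k.+1%:R^-1}.
    apply: cid; have [|q /=] := @rat_in_itvoo R (f t 0 i - k.+1%:R^-1) (f t 0 i + k.+1%:R^-1).
      by rewrite ltrD2l gtrN // invr_gt0.
    by rewrite in_itv /= => ?; exists q; rewrite distrC ltr_distl.
  exists (\row_i projT1 (q_ i), k) => //.
  case: pselect => [bU|nbU]; first by move=> i; rewrite /= mxE; case: (q_ i).
  exfalso; apply: nbU => v bv; apply: eU; split => // i j.
  rewrite ord1 /ball /= (splitr e).
  have := bv j; rewrite /= mxE; case: (q_ j) => q /= q1 q2.
  rewrite (le_lt_trans (ler_distD (ratr q) _ _)) // ltrD // (lt_trans _ ke) //.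
  by rewrite distrC.
apply: countable_bigcupT_measurable => [|qk]; first exact: countableP.
by case: pselect => _ /=; [exact: mbox|exact: measurable0].
Qed.

Lemma measurable_cons_rV n : measurable_fun setT (@cons_rV n).
Proof.
apply: measurable_to_rV => i; case: (unliftP ord0 i) => [j|] ->.
  apply: (eq_measurable_fun (fun p : R * 'rV[R]_n => p.2 0 j)).
    by move=> p _; rewrite mxE liftK.
  exact: (measurableT_comp (measurable_coord 0 j)).
apply: (eq_measurable_fun (fun p : R * 'rV[R]_n => p.1)) => [p _|].
  by rewrite mxE unlift_none.
exact: measurable_fst.
Qed.

Section step.
Local Open Scope ereal_scope.
Variables (n : nat) (mu : {sigma_finite_measure set 'rV[R]_n -> \bar R}).

Definition lebesgue_cons : set 'rV[R]_n.+1 -> \bar R :=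
  pushforward (@lebesgue_measure R \x mu) (@cons_rV n).

Let lebesgue_cons0 : lebesgue_cons set0 = 0.
Proof. by rewrite /lebesgue_cons /pushforward preimage_set0 measure0. Qed.

Let lebesgue_cons_ge0 A : 0 <= lebesgue_cons A.
Proof. by rewrite /lebesgue_cons /pushforward; exact: measure_ge0. Qed.

Let lebesgue_cons_sigma_additive : semi_sigma_additive lebesgue_cons.
Proof.
exact: (pushforward_additive (mu := @lebesgue_measure R \x mu) (@measurable_cons_rV n)).
Qed.

HB.instance Definition _ := isMeasure.Build _ _ _ lebesgue_cons
  lebesgue_cons0 lebesgue_cons_ge0 lebesgue_cons_sigma_additive.

Let lebesgue_cons_sigma_finite : sigma_finite setT lebesgue_cons.
Proof.
have [G [GT ndG Goo]] := (sigma_finiteP _ _).1 (sigma_finiteT (@lebesgue_measure R)).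
have [H [HT ndH Hoo]] := (sigma_finiteP _ _).1 (sigma_finiteT mu).
pose F k : set (measurableTypeR R * 'rV[R]_n) := G k `*` H k.
have FT : setT = \bigcup_k F k.
  rewrite -setXTT GT HT predeqE => -[x y]; split; last first.
    by move=> [k _ [/= ? ?]]; split; exists k.
  move=> [/= [i _ Gx] [j _ Hy]]; exists (maxn i j) => //; split.
    by move: x Gx; exact/subsetPset/ndG/leq_maxl.
  by move: y Hy; exact/subsetPset/ndH/leq_maxr.
have Ffin k : measurable (F k) /\ (@lebesgue_measure R \x mu) (F k) < +oo.
  have [? ?] := Goo k; have [? ?] := Hoo k; split; first exact: measurableX.
  by rewrite product_measure1E// lte_mul_pinfty// ge0_fin_numE.
pose h (v : 'rV[R]_n.+1) : R * 'rV[R]_n := (v ord0 ord0, \row_j v ord0 (lift ord0 j)).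
have mh : measurable_fun setT h.
  apply: measurable_fun_pair; first exact: measurable_coord.
  apply: measurable_to_rV => i.
  apply: (eq_measurable_fun (fun v : 'rV[R]_n.+1 => v ord0 (lift ord0 i))).
    by move=> v _; rewrite mxE.
  exact: measurable_coord.
have hK p : h (cons_rV p) = p.
  case: p => x v; congr pair; first by rewrite mxE unlift_none.
  by apply/rowP => j; rewrite !mxE liftK.
exists (fun k => h @^-1` F k).
  by rewrite -preimage_bigcup -FT preimage_setT.
move=> k; have [mF Foo] := Ffin k; split.
  by rewrite -[X in measurable X]setTI; exact: mh.
rewrite /lebesgue_cons /pushforward -comp_preimage.
by rewrite (_ : h \o _ = id) ?preimage_id //; apply/funext => p; exact: hK.
Qed.

HB.instance Definition _ := Measure_isSigmaFinite.Build _ _ _ lebesgue_cons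
  lebesgue_cons_sigma_finite.

End step.

(* The n-fold product of the one-dimensional Lebesgue measure. *)
Fixpoint lebesgue_rV n : {sigma_finite_measure set 'rV[R]_n -> \bar R} :=
  match n with
  | 0%N => \d_(0 : 'rV[R]_0)%R
  | n'.+1 => lebesgue_cons (lebesgue_rV n')
  end.
End lebesgue_rV.
Arguments lebesgue_rV {R}.

Section torus.
Variables (R : realType) (d : nat).
Local Open Scope quotient_scope.

Definition zlattice_rel (x y : 'rV[R]_d) : bool :=
  [forall i, (x - y) 0 i \is a Num.int].

Lemma zlattice_equiv : equiv_class_of zlattice_rel.
Proof.
split=> [x|x y|y x z].
- by apply/forallP => i; rewrite subrr mxE rpred0.
- by apply: eq_forallb => i; rewrite -opprB mxE rpredN.
- move=> /forallP xy /forallP yz; apply/forallP => i.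
  by rewrite -(subrK y x) -addrA mxE rpredD.
Qed.

Definition zlattice := EquivRelPack zlattice_equiv.

(* R^d / Z^d with its quotient topology and its Borel sigma-algebra. *)
Definition torus := quotient_topology {eq_quot zlattice}.

HB.instance Definition _ := Topological.on torus.
HB.instance Definition _ := isPointed.Build torus (\pi_torus 0).
HB.instance Definition _ :=
  @isMeasurable.Build (sigma_display (@open torus)) torus
    <<s @open torus >> (@sigma_algebra0 _ setT _)
    (@sigma_algebraC _ _) (@sigma_algebra_bigcup _ setT _).

Definition to_torus (x : 'rV[R]_d) : torus := \pi_torus x.

Lemma measurable_to_torus : measurable_fun setT to_torus.
Proof.
apply: (@measurability _ _ _ _ _ _ (@open torus)) => // _ [U oU <-].
rewrite setTI; apply: sub_sigma_algebra.
by apply: open_comp => // x _; exact: pi_continuous.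
Qed.

Definition unit_cube : set 'rV[R]_d := [set x | forall i, 0 <= x 0 i < 1].

Lemma measurable_unit_cube : measurable unit_cube.
Proof.
rewrite (_ : unit_cube =
  \bigcap_(i in [set: 'I_d]) ((fun x : 'rV[R]_d => x 0 i) @^-1` `[0, 1[%classic)).
  apply: fin_bigcap_measurable => [|i _]; first exact: finite_finset.
  by rewrite -[X in measurable X]setTI; exact: measurable_coord.
apply/seteqP; split=> [x cx i _|x cx i] /=; first by rewrite in_itv /= cx.
by have := cx i Logic.I; rewrite /= in_itv.
Qed.

Definition lebesgue_torus : set torus -> \bar R :=
  pushforward (mrestr (lebesgue_rV d) measurable_unit_cube) to_torus.

Let lebesgue_torus0 : lebesgue_torus set0 = 0%E.
Proof. by rewrite /lebesgue_torus /pushforward preimage_set0 measure0. Qed.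

Let lebesgue_torus_ge0 A : (0 <= lebesgue_torus A)%E.
Proof. by rewrite /lebesgue_torus /pushforward; exact: measure_ge0. Qed.

Let lebesgue_torus_sigma_additive : semi_sigma_additive lebesgue_torus.
Proof.
exact: (pushforward_additive (mu := mrestr (lebesgue_rV d) measurable_unit_cube)
  measurable_to_torus).
Qed.

HB.instance Definition _ := isMeasure.Build _ _ _ lebesgue_torus
  lebesgue_torus0 lebesgue_torus_ge0 lebesgue_torus_sigma_additive.

End torus.
Arguments to_torus {R d}.
Arguments lebesgue_torus : clear implicits.

Section euclidean.
Variables (R : realType) (n : nat).

(* The library norm on row vectors is the sup norm. *)
Definition enorm (v : 'rV[R]_n) : R := Num.sqrt (\sum_i v 0 i ^+ 2).
Definition eball (x : 'rV[R]_n) (r : R) : set 'rV[R]_n :=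
  [set y | enorm (y - x) < r].
Definition unit_ball : set 'rV[R]_n := eball 0 1.
Definition unit_sphere : set 'rV[R]_n := [set z | enorm z = 1].

End euclidean.
Arguments unit_ball {R n}.
Arguments unit_sphere {R n}.

Section measures.
Context (d : measure_display) (T : measurableType d) (R : realType).
Implicit Types (f g : T -> R) (ref : {measure set T -> \bar R}).

(* Measurability and integrability with respect to the completion of mu,
   mu being only required to be a function on measurable sets. *)
Definition completion_measurable (mu : set T -> \bar R) (D : set T) f :=
  exists2 g, measurable_fun setT g & mu.-negligible (D `&` [set t | f t <> g t]).

Definition completion_integrable ref f :=
  exists2 g, ref.-integrable setT (EFin \o g) & {ae ref, forall t, f t = g t}.

Definition singular_to (s : set T -> \bar R) ref :=
  exists N, [/\ measurable N, ref N = 0%E &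
    forall A, measurable A -> A `<=` ~` N -> s A = 0%E].

(* mu = f ref + mus with mus singular to ref; f is a nonnegative pointwise
   representative of the density. *)
Definition lebesgue_decomposition (mu ref : {measure set T -> \bar R}) f
    (mus : {finite_measure set T -> \bar R}) :=
  [/\ measurable_fun setT f, forall t, 0 <= f t, singular_to mus ref &
    forall A, measurable A -> mu A = (\int[ref]_(t in A) (f t)%:E + mus A)%E].

(* u is the density, with respect to ref, of the ref-absolutely continuous part
   of the signed measure beta. *)
Definition is_RN_density ref (beta : set T -> R) (u : T -> R) :=
  ref.-integrable setT (EFin \o u) /\
  exists2 s : {charge set T -> \bar R}, singular_to s ref &
    forall A, measurable A ->
      (beta A)%:E = (\int[ref]_(t in A) (u t)%:E + s A)%E.

(* Integral against a signed measure, through its Jordan decomposition. *)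
Definition charge_integral (nu : {charge set T -> \bar R}) f : R :=
  let P := cid (Hahn_decomposition nu) in
  let N := cid (projT2 P) in
  \int[jordan_pos (projT2 N)]_t f t - \int[jordan_neg (projT2 N)]_t f t.

Definition vector_variation m (nu : set T -> 'rV[R]_m) (A : set T) : \bar R :=
  ereal_sup [set (\sum_(0 <= k <oo) (enorm (nu (P k)))%:E)%E | P in
    [set P : (set T)^nat | [/\ forall k, measurable (P k), trivIset setT P &
                               \bigcup_k P k = A]]].

End measures.

(* Elements of C_0(K), as functions on the ambient space. *)
Definition C0 (R : realType) (S : topologicalType) (K : set S) : set (S -> R) :=
  [set phi | {within K, continuous phi} /\
    forall e : R, 0 < e -> exists2 C, compact C &
      forall z, K z -> ~ C z -> `|phi z| < e].

(* K is a closed set on which the measures kappa t are concentrated, and test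
   is meant to be C_0(K). *)
Definition weakstar_measurable (R : realType) (d d' : measure_display)
    (T : measurableType d) (S : measurableType d') (mu : set T -> \bar R)
    (D : set T) (K : set S) (test : set (S -> R))
    (kappa : T -> probability S R) :=
  forall phi, test phi ->
    completion_measurable mu D (fun t => \int[kappa t]_(z in K) phi z).

(* The set function underlying mu (x) kappa_x on D x T2. *)
Definition semidirect (R : realType) (d1 d2 : measure_display)
    (T1 : measurableType d1) (T2 : measurableType d2)
    (mu : {measure set T1 -> \bar R}) (D : set T1)
    (kappa : T1 -> set T2 -> \bar R) : set (T1 * T2) -> \bar R :=
  fun N => (\int[mu]_(x in D) kappa x (xsection N x))%E.

Section young_measures.
Variables (R : realType) (d m : nat).
Local Notation X := 'rV[R]_d.
Local Notation Z := (torus R d).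
Local Notation E := 'rV[R]_m.
Local Notation Ld := (@lebesgue_rV R d).
Local Notation LZ := (lebesgue_torus R d).
Implicit Types (Omega : set X) (f : X -> Z -> E -> R).

(* Two-scale* Young measures (nu, lambda, rho, nu^infty), in this order. The
   maps are total; only their values at points of closure Omega matter. *)
Record young2 Omega := Young2 {
  osc : X -> Z -> probability E R ;
  conc : {finite_measure set X -> \bar R} ;
  conc_scale : X -> probability Z R ;
  conc_dir : X -> Z -> probability E R ;
  osc_measurable :
    weakstar_measurable (semidirect Ld (closure Omega) (fun=> LZ))
      (closure Omega `*` setT) setT (C0 [set: E]) (fun q => osc q.1 q.2) ;
  osc_moment : (\int[Ld]_(x in closure Omega) \int[LZ]_xi
    \int[osc x xi]_z (enorm z)%:E < +oo)%E ;
  conc_support : conc (~` closure Omega) = 0%E ;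
  conc_scale_measurable :
    weakstar_measurable conc (closure Omega) setT (C0 [set: Z]) conc_scale ;
  conc_dir_sphere : forall x xi, closure Omega x ->
    conc_dir x xi unit_sphere = 1%E ;
  conc_dir_measurable :
    weakstar_measurable
      (semidirect conc (closure Omega) (fun x => conc_scale x))
      (closure Omega `*` setT) unit_sphere (C0 (unit_sphere : set E))
      (fun q => conc_dir q.1 q.2)
}.

Definition recession_filter Omega (x : X) (xi : Z) : set_system (X * Z * R) :=
  filter_prod (filter_prod (within Omega (nbhs x)) (nbhs xi)) (pinfty_nbhs R).

Definition recession_quotient f (z : E) (q : X * Z * R) : R :=
  f q.1.1 q.1.2 (q.2 *: z) / q.2.

(* The recession function is taken at points of closure Omega, along points
   of Omega. *)
Definition recession Omega f : X -> Z -> E -> R := fun x xi z =>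
  lim (recession_quotient f z @ recession_filter Omega x xi).

(* f^# and f_# *)
Definition upper_recession Omega f x xi z : \bar R :=
  limf_esup (EFin \o recession_quotient f z) (recession_filter Omega x xi).

Definition lower_recession Omega f x xi z : \bar R :=
  limf_einf (EFin \o recession_quotient f z) (recession_filter Omega x xi).

Definition R2 Omega : set (X -> Z -> E -> R) :=
  [set f | {within Omega `*` setT `*` setT,
             continuous (fun q : X * Z * E => f q.1.1 q.1.2 q.2)} /\
    forall x xi z, closure Omega x ->
      upper_recession Omega f x xi z = (recession Omega f x xi z)%:E /\
      lower_recession Omega f x xi z = (recession Omega f x xi z)%:E].

Definition E2 Omega : set (X -> Z -> E -> R) :=
  [set f | {within Omega `*` setT `*` setT,
             continuous (fun q : X * Z * E => f q.1.1 q.1.2 q.2)} /\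
    exists2 g : X * Z * E -> R,
      {within closure (Omega `*` setT `*` unit_ball), continuous g} &
      forall x xi zh, Omega x -> unit_ball zh ->
        g (x, xi, zh) =
          (1 - enorm zh) * f x xi ((1 - enorm zh)^-1 *: zh)].

(* M(Omega; E), by components *)
Definition vector_measure_on Omega (mu : 'I_m -> {charge set X -> \bar R}) :=
  forall i A, measurable A -> A `<=` ~` Omega -> mu i A = 0%E.

(* mu = a Ld + s sigma, where sigma is the total variation of the part of mu
   singular to Ld. *)
Definition RNL_decomposition Omega (mu : 'I_m -> {charge set X -> \bar R})
    (a s : X -> E) (sigma : {finite_measure set X -> \bar R}) :=
  let mu_s (A : set X) : E :=
    \row_i (fine (mu i A) - \int[Ld]_(x in A `&` Omega) a x 0 i) in
  [/\ forall i, Ld.-integrable Omega (fun x => (a x 0 i)%:E),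
      singular_to sigma Ld,
      forall A, measurable A -> sigma A = vector_variation mu_s A,
      forall i, sigma.-integrable setT (fun x => (s x 0 i)%:E) &
      forall i A, measurable A -> mu_s A 0 i = \int[sigma]_(x in A) s x 0 i].

Definition generates Omega (eps : R^nat)
    (mu : nat -> 'I_m -> {charge set X -> \bar R}) (nu : young2 Omega) :=
  exists (a s : nat -> X -> E) (sigma : nat -> {finite_measure set X -> \bar R}),
    (forall n, RNL_decomposition Omega (mu n) (a n) (s n) (sigma n)) /\
    forall f, E2 Omega f ->
      (fun n =>
        \int[Ld]_(x in Omega) f x (to_torus ((eps n)^-1 *: x)) (a n x) +
        \int[sigma n]_(x in Omega)
          recession Omega f x (to_torus ((eps n)^-1 *: x)) (s n x)) @ \oo -->
      \int[Ld]_(x in Omega) \int[LZ]_xi \int[osc nu x xi]_z f x xi z +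
      \int[conc nu]_(x in closure Omega) \int[conc_scale nu x]_xi
        \int[conc_dir nu x xi]_(z in unit_sphere) recession Omega f x xi z.

End young_measures.

Section differential_operators.
Variables (R : realType) (d m l k : nat).
Local Notation X := 'rV[R]_d.
Local Notation E := 'rV[R]_m.
Local Notation F := 'rV[R]_l.
Local Notation mindex := {ffun 'I_d -> 'I_k.+1}.
Implicit Types (Omega : set X) (phi : X -> F) (alpha : mindex).

Definition iterated_pderiv (w : seq 'I_d) phi : X -> F :=
  foldr (fun i g x => 'D_(delta_mx 0 i) g x) phi w.

(* phi is smooth with compact support in Omega. *)
Definition test_function Omega phi :=
  (forall w, continuous (iterated_pderiv w phi) /\
    forall x i, derivable (iterated_pderiv w phi) x (delta_mx 0 i)) /\
  exists2 K, compact K /\ K `<=` Omega & forall x, ~ K x -> phi x = 0.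

Definition mindex_order alpha : nat := (\sum_i alpha i)%N.

Definition pderiv alpha phi : X -> F :=
  iterated_pderiv (flatten [seq nseq (alpha i) i | i <- enum 'I_d]) phi.

(* < A mu, phi > in the sense of distributions, for A the sum of
   A_alpha D^alpha over |alpha| = k. *)
Definition op_pairing (A : mindex -> 'Hom(E, F))
    (mu : 'I_m -> {charge set X -> \bar R}) phi : R :=
  (-1) ^+ k * \sum_(alpha | mindex_order alpha == k) \sum_(i < m)
    charge_integral (mu i) (fun x =>
      \sum_(j < l) A alpha (delta_mx 0 i) 0 j * pderiv alpha phi x 0 j).

Definition sobolev_norm (q : R) Omega phi : R :=
  (\sum_(alpha : mindex | (mindex_order alpha <= k)%N)
     \int[lebesgue_rV d]_(x in Omega) enorm (pderiv alpha phi x) `^ q) `^ q^-1.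

(* Dual norm of W_0^{k,p'}, p' = p / (p - 1), in which test functions are
   dense. *)
Definition neg_sobolev_norm (p : R) Omega (T : (X -> F) -> R) : \bar R :=
  ereal_sup [set `|T phi|%:E | phi in
    [set phi | test_function Omega phi /\
               sobolev_norm (p / (p - 1)) Omega phi <= 1]].

Definition A_free (A : mindex -> 'Hom(E, F)) (p : R) Omega
    (nu : young2 m Omega) :=
  exists (eps : R^nat) (mu : nat -> 'I_m -> {charge set X -> \bar R}),
    [/\ forall n, 0 < eps n, nonincreasing_seq eps & eps @ \oo --> (0 : R)] /\
    [/\ forall n, vector_measure_on Omega (mu n), generates eps mu nu &
        (fun n => neg_sobolev_norm p Omega (op_pairing A (mu n))) @ \oo
          --> 0%E].

End differential_operators.

Section regular_points.
Variables (R : realType) (d m : nat).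
Local Notation X := 'rV[R]_d.
Local Notation Z := (torus R d).
Local Notation E := 'rV[R]_m.
Local Notation Ld := (@lebesgue_rV R d).
Local Notation LZ := (lebesgue_torus R d).
Variable Omega : set X.

(* d Ld / d lambda_s vanishes at x; off the support of lambda_s this
   derivative is +oo. *)
Definition singular_point (lambda_s : {finite_measure set X -> \bar R}) :
    set X :=
  [set x | [/\ closure Omega x, forall r, 0 < r -> (0 < lambda_s (eball x r))%E &
    fine (Ld (eball x r)) / fine (lambda_s (eball x r)) @[r --> 0^'+] -->
      (0 : R)]].

Definition regular_point lambda_s : set X :=
  closure Omega `\` singular_point lambda_s.

(* Common form of the second-scale barycenters at x. *)
Definition barycenter (lambda_ac : X -> R) (nu : young2 m Omega) (x : X)
    (g ginf : Z -> E -> R) (V : set Z) : R :=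
  \int[LZ]_(xi in V) (\int[osc nu x xi]_z g xi z) +
  lambda_ac x * \int[conc_scale nu x]_(xi in V)
    (\int[conc_dir nu x xi]_(z in unit_sphere) ginf xi z).

(* The integrals in barycenter converge, so that it is a signed measure on Z.
   For the integrands used here this holds, by Fubini, at Lebesgue-almost every
   regular point. *)
Definition barycenter_defined (lambda_ac : X -> R) (nu : young2 m Omega) (x : X)
    (g ginf : Z -> E -> R) :=
  [/\ {ae LZ, forall xi, (osc nu x xi).-integrable setT (EFin \o g xi)},
      completion_integrable LZ (fun xi => \int[osc nu x xi]_z g xi z) &
      lambda_ac x != 0 -> completion_integrable (conc_scale nu x)
        (fun xi => \int[conc_dir nu x xi]_(z in unit_sphere) ginf xi z)].

Definition coord (i : 'I_m) : Z -> E -> R := fun _ z => z 0 i.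

(* Coordinates of the barycenter of the identity *)
Definition id_barycenter lambda_ac nu x i : set Z -> R :=
  barycenter lambda_ac nu x (coord i) (coord i).

Definition id_barycenter_defined lambda_ac nu x :=
  forall i, barycenter_defined lambda_ac nu x (coord i) (coord i).

Definition fun_barycenter lambda_ac nu x (f : X -> Z -> E -> R) : set Z -> R :=
  barycenter lambda_ac nu x (f x) (recession Omega f x).

Definition fun_barycenter_defined lambda_ac nu x (f : X -> Z -> E -> R) :=
  barycenter_defined lambda_ac nu x (f x) (recession Omega f x).

End regular_points.

(* Main.v *)
Require Import Defs.
From HB Require Import structures.
From mathcomp Require Import all_boot all_order all_algebra.
From mathcomp Require Import all_classical all_reals all_analysis.
From mathcomp Require Import measurable_realfun ring lra.
Set Implicit Arguments.
Unset Strict Implicit.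
Unset Printing Implicit Defensive.
Import Order.TTheory GRing.Theory Num.Theory.
Import numFieldNormedType.Exports.
Local Open Scope classical_set_scope.
Local Open Scope ring_scope.

(* For convex h both inequalities are Jensen's inequality at a fixed x. Write
   all measures on the torus with densities with respect to
   sigma = Lebesgue + rho_x: f for Lebesgue, g for rho_x and s for the measure
   in which the barycenter is differentiated. The density u of the barycenter
   satisfies u s = a f + lambda b g, where a and b are the means of nu_{x,xi}
   and nu^infty_{x,xi}, and similarly for h. In (i), s = f and u = a + c b
   with c = lambda g / f >= 0; in (ii), s is the density of rho_x^s, so f = 0
   where s > 0, and u = c b with c = lambda g / s >= 0. A subgradient of
   h(xi, .) at u is a linear minorant of h^infty(xi, .), so integrating it
   against nu_{x,xi} and c nu^infty_{x,xi} gives (i); (ii) is the same argument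
   for the sublinear function h^infty(xi, .). *)

(** * Convex functions and their recession functions *)

Section convex_rV.
Variables (R : realType) (n : nat).
Implicit Types (c x y z a : 'rV[R]_n) (h : 'rV[R]_n -> R).

Definition dot c z : R := \sum_i c 0 i * z 0 i.

Lemma dotDr c y z : dot c (y + z) = dot c y + dot c z.
Proof. by rewrite -big_split; apply: eq_bigr => i _; rewrite mxE mulrDr. Qed.

Lemma dotZr c t z : dot c (t *: z) = t * dot c z.
Proof. by rewrite mulr_sumr; apply: eq_bigr => i _; rewrite mxE mulrCA. Qed.

Lemma dotBr c y z : dot c (y - z) = dot c y - dot c z.
Proof. by rewrite dotDr -scaleN1r dotZr mulN1r. Qed.

Lemma dot0r c : dot c 0 = 0.
Proof. by rewrite -(scale0r 0) dotZr mul0r. Qed.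

Lemma dotDl c y z : dot (y + z) c = dot y c + dot z c.
Proof. by rewrite -big_split; apply: eq_bigr => i _; rewrite mxE mulrDl. Qed.

Lemma dot_delta t k z : dot (t *: delta_mx 0 k) z = t * z 0 k.
Proof.
rewrite /dot (bigD1 k)//= !mxE !eqxx mulr1 big1 ?addr0// => i ik.
by rewrite !mxE (negbTE ik) andbF mulr0 mul0r.
Qed.

Definition convex_fun h := forall t x y, 0 <= t <= 1 ->
  h (t *: x + (1 - t) *: y) <= t * h x + (1 - t) * h y.

Lemma convex_function_fun h :
  convex_function [set: convex_lmodType 'rV[R]_n] h -> convex_fun h.
Proof.
move=> ch t x y /andP[t0 t1].
by have := ch (Itv01 t0 t1) x y; rewrite !in_setT => /(_ isT isT).
Qed.

(* The slope along a new coordinate lies between the difference quotients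
   to its left and to its right, as in the proof of Hahn-Banach. *)
Lemma subgradient_upto h a j : convex_fun h -> (j <= n)%N -> exists c,
  forall y, (forall i : 'I_n, (j <= i)%N -> y 0 i = 0) ->
    h a + dot c y <= h (a + y).
Proof.
move=> ch; elim: j => [_|j IH jn].
  exists 0 => y y0; have -> : y = 0 by apply/rowP => i; rewrite y0// mxE.
  by rewrite dot0r !addr0.
have [c hc] := IH (ltnW jn); pose k := Ordinal jn.
pose e : 'rV[R]_n := delta_mx 0 k.
pose V y := forall i : 'I_n, (j <= i)%N -> y 0 i = 0.
pose left p := (h a + dot c p.1 - h (a + p.1 - p.2 *: e)) / p.2.
pose S := [set left p | p in [set p : 'rV[R]_n * R | V p.1 /\ 0 < p.2]].
have slopes y y2 (s t : R) : V y -> V y2 -> 0 < s -> 0 < t ->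
    left (y2, s) <= (h (a + y + t *: e) - h a - dot c y) / t.
  move=> Vy Vy2 s0 t0; have st0 : 0 < s + t by rewrite addr_gt0.
  rewrite /left /= ler_pdivrMr// mulrAC ler_pdivlMr//.
  pose th := s / (s + t).
  have th1 : 1 - th = t / (s + t) by rewrite /th; field; lra.
  have th01 : 0 <= th <= 1.
    rewrite /th divr_ge0 ?(ltW s0) ?(ltW st0)//= ler_pdivrMr// mul1r; lra.
  have := hc (th *: y + (1 - th) *: y2).
  have -> : a + (th *: y + (1 - th) *: y2) =
      th *: (a + y + t *: e) + (1 - th) *: (a + y2 - s *: e).
    by apply/rowP => i; rewrite !mxE th1 /th; field; lra.
  move=> /(_ _)/le_trans H.
  have := H _ _ (ch _ _ _ th01); rewrite dotDr !dotZr th1 /th.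
  set A := h (_ + _ + _); set B := h (_ - _); set X := dot c y.
  set Y := dot c y2.
  have -> : h a + (s / (s + t) * X + t / (s + t) * Y) =
     (h a * (s + t) + (s * X + t * Y)) / (s + t) by field; lra.
  have -> : s / (s + t) * A + t / (s + t) * B = (s * A + t * B) / (s + t).
    by field; lra.
  move=> H'; have {}H' : h a * (s + t) + (s * X + t * Y) <= s * A + t * B.
    move: H'; rewrite ler_pM2r ?invr_gt0//; apply.
    by move=> i ji; rewrite !mxE Vy// Vy2// !mulr0 addr0.
  move: H'; nra.
have V0 : V 0 by move=> i _; rewrite mxE.
have supS : has_sup S.
  split; first by exists (left (0, 1)), (0, 1) => //; split.
  exists ((h (a + 0 + 1 *: e) - h a - dot c 0) / 1).
  by move=> _ [[y2 s] [/= Vy2 s0] <-]; exact: slopes.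
exists (c + (sup S - c 0 k) *: e) => y' Vy'.
pose tau : R := y' 0 k; pose y := y' - tau *: e.
have Vy : V y.
  move=> i; rewrite leq_eqVlt => /predU1P[ji|ji]; rewrite !mxE.
    by have -> : i = k by [apply/val_inj]; rewrite !eqxx mulr1 subrr.
  rewrite Vy'// (_ : i == k = false) ?andbF ?mulr0 ?subr0//.
  by apply/negbTE; apply: contraTneq ji => ->; rewrite ltnn.
have ye : y' = y + tau *: e by rewrite subrK.
have -> : dot (c + (sup S - c 0 k) *: e) y' = dot c y + sup S * tau.
  rewrite dotDl dot_delta -/tau /y dotBr dotZr.
  have -> : dot c e = c 0 k.
    rewrite /dot (bigD1 k)//= mxE !eqxx mulr1 big1 ?addr0// => i ik.
    by rewrite mxE (negbTE ik) andbF mulr0.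
  by ring.
rewrite ye (addrA a y); have [tau0|tau0|->] := ltgtP tau 0.
- have ntau0 : 0 < - tau by rewrite oppr_gt0.
  have : left (y, - tau) <= sup S.
    by apply: ub_le_sup; [case: supS|exists (y, - tau)].
  rewrite /left/= ler_pdivrMr// scaleNr opprK; lra.
- have : sup S <= (h (a + y + tau *: e) - h a - dot c y) / tau.
    apply: ge_sup; first by case: supS.
    by move=> _ [[y2 s] [/= Vy2 s0] <-]; exact: slopes.
  by rewrite ler_pdivlMr//; lra.
- by rewrite mulr0 scale0r !addr0; exact: hc.
Qed.

Lemma subgradient h a : convex_fun h ->
  exists c, forall z, h a + dot c (z - a) <= h z.
Proof.
move=> /(subgradient_upto a)/(_ (leqnn n))[c hc]; exists c => z.
have := hc (z - a); rewrite (addrC a) subrK; apply => i.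
by rewrite leqNgt ltn_ord.
Qed.

End convex_rV.

Lemma norm_coord_le1 (R : realType) (n : nat) (z : 'rV[R]_n) i :
  enorm z = 1 -> `|z 0 i| <= 1.
Proof.
move=> z1; have s1 : \sum_i z 0 i ^+ 2 = 1.
  rewrite -[LHS]sqr_sqrtr ?sumr_ge0// => [|j _]; last exact: sqr_ge0.
  by rewrite [X in X ^+ 2]z1 expr1n.
rewrite -sqrtr_sqr -[leRHS]sqrtr1 ler_wsqrtr// -s1 (bigD1 i)//=.
by rewrite lerDl sumr_ge0// => j _; exact: sqr_ge0.
Qed.

Definition recession_limit (R : realType) (n : nat) (h G : 'rV[R]_n -> R) :=
  forall z, h (t *: z) / t @[t --> +oo] --> G z.

Section recession_of_convex.
Variables (R : realType) (n : nat) (h G : 'rV[R]_n -> R).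
Hypothesis ch : convex_fun h.
Hypothesis hG : recession_limit h G.

Lemma recession_minorant a c : (forall z, h a + dot c (z - a) <= h z) ->
  forall z, dot c z <= G z.
Proof.
move=> hc z.
have inv0 : (h a - dot c a) * t^-1 @[t --> +oo] --> (0 : R).
  rewrite -(mulr0 (h a - dot c a)); apply: cvgMr.
  by apply/gtr0_cvgV0 => //; exact: nbhs_pinfty_gt.
have cL : (h a - dot c a) * t^-1 + dot c z @[t --> +oo] --> 0 + dot c z.
  by apply: cvgD => //; exact: cvg_cst.
rewrite -[leLHS]add0r; apply: (ler_cvg_to cL (@hG z)).
near=> t; have t0 : 0 < t by near: t; exact: nbhs_pinfty_gt.
rewrite ler_pdivlMr// mulrDl mulfVK ?gt_eqF//.
by apply: le_trans (hc _); rewrite dotBr dotZr; lra.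
Unshelve. all: by end_near. Qed.

Lemma recession_convex : convex_fun G.
Proof.
move=> s x y s01.
have cR : s * (h (t *: x) / t) + (1 - s) * (h (t *: y) / t) @[t --> +oo] -->
    s * G x + (1 - s) * G y.
  by apply: cvgD; apply: cvgMr.
apply: (ler_cvg_to (@hG _) cR).
near=> t; have t0 : 0 < t by near: t; exact: nbhs_pinfty_gt.
rewrite !mulrA -mulrDl ler_pM2r ?invr_gt0//.
by rewrite scalerDr !scalerA !(mulrC t) -!scalerA; exact: ch.
Unshelve. all: by end_near. Qed.

Lemma recession0 : G 0 = 0.
Proof.
have inv0 : h 0 * t^-1 @[t --> +oo] --> (0 : R).
  rewrite -(mulr0 (h 0)); apply: cvgMr.
  by apply/gtr0_cvgV0 => //; exact: nbhs_pinfty_gt.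
apply: (cvg_unique (@norm_hausdorff _ _) _ inv0).
by have := @hG 0; under eq_fun do rewrite scaler0.
Qed.

Lemma recession_homogeneous s z : 0 < s -> G (s *: z) = s * G z.
Proof.
move=> s0; have cvgs : s * t @[t --> +oo] --> +oo by exact: gt0_cvgMry.
have cR : s * (h ((s * t) *: z) / (s * t)) @[t --> +oo] --> s * G z.
  by apply: cvgMr; exact: (cvg_comp _ (fun t => h (t *: z) / t) cvgs (@hG z)).
apply: (cvg_unique (@norm_hausdorff _ _) (@hG _)); apply: cvg_trans cR.
apply: near_eq_cvg; near=> t.
have t0 : 0 < t by near: t; exact: nbhs_pinfty_gt.
rewrite /= scalerA (mulrC t s); field; lra.
Unshelve. all: by end_near. Qed.

Lemma recessionD x y : G (x + y) <= G x + G y.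
Proof.
have half01 : 0 <= (2^-1 : R) <= 1 by lra.
have := recession_convex x y half01.
have -> : 1 - 2^-1 = 2^-1 :> R by lra.
rewrite -scalerDr recession_homogeneous ?invr_gt0// -mulrDr.
by rewrite ler_pM2l ?invr_gt0.
Qed.

Lemma recession_bounded : exists C, forall z, enorm z = 1 -> `|G z| <= C.
Proof.
pose e (i : 'I_n) : 'rV[R]_n := delta_mx 0 i.
have [c hc] := subgradient 0 recession_convex.
pose U : R := \sum_i (`|G (e i)| + `|G (- e i)|); pose D : R := \sum_i `|c 0 i|.
exists (D + U) => z z1; have zi i := norm_coord_le1 i z1.
have U0 : 0 <= U by rewrite sumr_ge0// => i _; rewrite addr_ge0.
have D0 : 0 <= D by rewrite sumr_ge0.
rewrite ler_norml; apply/andP; split.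
  have : `|dot c z| <= D.
    apply: le_trans (ler_norm_sum _ _ _) _; apply: ler_sum => i _.
    by rewrite normrM ler_piMr.
  have := hc z; rewrite recession0 subr0 ler_norml => ? /andP[? _]; lra.
suff : G z <= U by lra.
rewrite [X in G X](row_sum_delta z); rewrite /U.
elim/big_rec2 : _ => [|i u v _ uv]; first by rewrite recession0.
apply: le_trans (recessionD _ _) _; apply: lerD => //.
have [zi0|zi0|->] := ltgtP (z 0 i) 0.
- rewrite -[X in G X]opprK -scaleNr -scalerN recession_homogeneous ?oppr_gt0//.
  apply: le_trans (_ : `|G (- e i)| <= _); last by rewrite lerDr.
  apply: le_trans (ler_norm _) _; rewrite normrM ler_piMl//.
  by rewrite normrN.
- rewrite recession_homogeneous//.
  apply: le_trans (_ : `|G (e i)| <= _); last by rewrite lerDl.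
  by apply: le_trans (ler_norm _) _; rewrite normrM ler_piMl.
- by rewrite scale0r recession0 addr_ge0.
Qed.

End recession_of_convex.

(** * Jensen's inequality with a concentration term *)

Lemma continuous_measurable_mx (R : realType) m n (f : 'M[R]_(m, n) -> R) :
  continuous f -> measurable_fun setT f.
Proof.
move=> cf; apply: (measurability _ (RGenOpens.measurableE R)).
move=> _ [_ [a [b ->] <-]]; rewrite setTI; apply: sub_sigma_algebra.
by apply: open_comp; [move=> x _; exact: cf|exact: interval_open].
Qed.

Section integral_dot.
Variables (R : realType) (n : nat) (mu : {measure set 'rV[R]_n -> \bar R}).
Variables (D : set 'rV[R]_n) (mD : measurable D).
Hypothesis icoord :
  forall i, mu.-integrable D (EFin \o (fun z : 'rV[R]_n => z 0 i : R)).

Let imul (c : 'rV[R]_n) i :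
  mu.-integrable D (EFin \o (fun z : 'rV[R]_n => c 0 i * z 0 i : R)).
Proof. by apply: (integrableZl mD (c 0 i) (icoord i)). Qed.

Lemma integrable_dot (c : 'rV[R]_n) : mu.-integrable D (EFin \o dot c).
Proof.
have := @integrable_sum _ _ _ mu D mD _ (index_enum 'I_n) xpredT _
  (fun i _ => imul c i).
by apply: eq_integrable => // z _; rewrite /= sumEFin.
Qed.

Lemma Rintegral_dot (c : 'rV[R]_n) :
  \int[mu]_(z in D) dot c z = dot c (\row_i \int[mu]_(z in D) z 0 i).
Proof.
rewrite /Rintegral (eq_integral (fun z =>
  \sum_(i < n) (EFin \o (fun z : 'rV[R]_n => c 0 i * z 0 i : R)%R) z)%E)
  => [|z _]; last first.
  by rewrite /= sumEFin.
rewrite integral_sum//.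
transitivity (fine (\sum_(i < n) (c 0 i * \int[mu]_(z in D) z 0 i)%:E)).
  congr fine; apply: eq_bigr => i _; rewrite -RintegralZl//.
  by rewrite /Rintegral fineK//; exact: (integrable_fin_num _ (imul c i)).
by rewrite sumEFin/=; apply: eq_bigr => i _; rewrite mxE.
Qed.

End integral_dot.

Lemma affine_le_Rintegral (R : realType) n (P : probability 'rV[R]_n R)
    (h : 'rV[R]_n -> R) a c :
    (forall i, P.-integrable setT (EFin \o (fun z : 'rV[R]_n => z 0 i : R))) ->
    P.-integrable setT (EFin \o h) ->
    (forall z, h a + dot c (z - a) <= h z) ->
  h a + dot c (\row_i \int[P]_z z 0 i - a) <= \int[P]_z h z.
Proof.
move=> icoord ih hc; have idot := integrable_dot measurableT icoord c.
have icst : P.-integrable setT (EFin \o cst (h a - dot c a)).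
  exact: finite_measure_integrable_cst.
rewrite dotBr -Rintegral_dot//.
suff -> : h a + (\int[P]_z dot c z - dot c a) =
    \int[P]_z (h a - dot c a + dot c z).
  apply: le_Rintegral => // [|z _]; last by have := hc z; rewrite dotBr; lra.
  exact: (integrableD measurableT icst idot).
rewrite RintegralD//.
have -> : \int[P]_z (h a - dot c a) = h a - dot c a.
  by rewrite Rintegral_cst// [X in fine X](probability_setT P) mulr1.
by ring.
Qed.

Lemma measurable_unit_sphere (R : realType) n :
  measurable (@unit_sphere R n).
Proof.
suff cn : continuous (@enorm R n).
  have := continuous_measurable_mx cn measurableT (measurable_set1 1).
  by rewrite setTI.
move=> v.
have csq i : (fun w : 'rV[R]_n => w 0 i ^+ 2) @ v --> v 0 i ^+ 2.
  have ci : (fun w : 'rV[R]_n => w 0 i) @ v --> v 0 i.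
    exact: coord_continuous.
  exact: (cvgM ci ci).
apply: (@continuous_comp _ _ _ (fun v : 'rV[R]_n => \sum_i v 0 i ^+ 2) Num.sqrt).
  apply: (cvg_big (@add_continuous R^o) _ (fun i _ => csq i)).
exact: sqrt_continuous.
Qed.

Section sphere.
Variables (R : realType) (n : nat) (P : probability 'rV[R]_n R).
Hypothesis P1 : P unit_sphere = 1%E.

Lemma integrable_coord_sphere i :
  P.-integrable unit_sphere (EFin \o (fun z : 'rV[R]_n => z 0 i : R)).
Proof.
apply: measurable_bounded_integrable.
- exact: measurable_unit_sphere.
- by rewrite [X in (X < _)%E]P1 ltry.
- by apply/measurable_funTS; exact: measurable_coord.
- exists 1; split=> // M M1 z /= z1.
  by rewrite (le_trans _ (ltW M1))// norm_coord_le1.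
Qed.

Lemma minorant_le_Rintegral_sphere (h G : 'rV[R]_n -> R) c :
    convex_fun h -> measurable_fun setT h -> recession_limit h G ->
    (forall z, dot c z <= G z) ->
  dot c (\row_i \int[P]_(z in unit_sphere) z 0 i)
    <= \int[P]_(z in unit_sphere) G z.
Proof.
move=> ch mh hG cG; have mS := @measurable_unit_sphere R n.
rewrite -Rintegral_dot//; last exact: integrable_coord_sphere.
apply: le_Rintegral => //; first exact: integrable_dot integrable_coord_sphere _.
apply: measurable_bounded_integrable => //.
- by rewrite [X in (X < _)%E]P1 ltry.
- apply: (@measurable_fun_cvg _ _ R unit_sphere
    (fun k (z : 'rV[R]_n) => h (k%:R *: z) / k%:R)).
    move=> k; apply: measurable_funM => //; apply/measurable_funTS.
    apply: measurableT_comp => //.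
    apply: measurable_to_rV => i.
    apply: (eq_measurable_fun (fun z : 'rV[R]_n => k%:R * z 0 i)).
      by move=> z _; rewrite mxE.
    by apply: measurable_funM => //; exact: measurable_coord.
  by move=> z _; exact: (cvg_comp _ (fun t => h (t *: z) / t) cvgr_idn (hG z)).
- have [C hC] := recession_bounded ch hG.
  exists C; split; first exact: num_real.
  by move=> M CM z /= z1; rewrite (le_trans (hC _ z1))// ltW.
Qed.

End sphere.

(* A subgradient c of h at a + s b satisfies dot c <= G, so it integrates
   against both measures. *)
Lemma jensen_recession (R : realType) n (P Q : probability 'rV[R]_n R)
    (h G : 'rV[R]_n -> R) s :
    convex_fun h -> recession_limit h G -> Q unit_sphere = 1%E ->
    (forall i, P.-integrable setT (EFin \o (fun z : 'rV[R]_n => z 0 i : R))) ->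
    P.-integrable setT (EFin \o h) -> 0 <= s ->
  h (\row_i (\int[P]_z z 0 i + s * \int[Q]_(z in unit_sphere) z 0 i)) <=
  \int[P]_z h z + s * \int[Q]_(z in unit_sphere) G z.
Proof.
move=> ch hG Q1 icoord ih s0; have mh : measurable_fun setT h.
  by apply/measurable_EFinP; exact: measurable_int ih.
set a := \row_i _; have [c hc] := subgradient a ch.
have := affine_le_Rintegral icoord ih hc.
have := minorant_le_Rintegral_sphere Q1 ch mh hG (recession_minorant hG hc).
set b := \row_i _; set z := \row_i _ => /(ler_wpM2l s0).
have -> : a = z + s *: b by apply/rowP => i; rewrite !mxE.
by rewrite opprD addNKr -scaleNr dotZr; lra.
Qed.

Lemma jensen_recession0 (R : realType) n (Q : probability 'rV[R]_n R)
    (h G : 'rV[R]_n -> R) s :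
    convex_fun h -> measurable_fun setT h -> recession_limit h G ->
    Q unit_sphere = 1%E -> 0 <= s ->
  G (\row_i (s * \int[Q]_(z in unit_sphere) z 0 i)) <=
  s * \int[Q]_(z in unit_sphere) G z.
Proof.
move=> ch mh hG Q1 s0; have cG := recession_convex ch hG.
have GG : recession_limit G G.
  move=> z; apply: cvg_near_cst; near=> t.
  have t0 : 0 < t by near: t; exact: nbhs_pinfty_gt.
  by rewrite (recession_homogeneous hG)// mulrAC mulfV ?mul1r// gt_eqF.
set a := \row_i _; have [c hc] := subgradient a cG.
have := minorant_le_Rintegral_sphere Q1 ch mh hG (recession_minorant GG hc).
set b := \row_i _ => /(ler_wpM2l s0).
have -> : a = s *: b by apply/rowP => i; rewrite !mxE.
have := hc 0; rewrite (recession0 hG) sub0r -scaleN1r dotZr.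
have -> : a = s *: b by apply/rowP => i; rewrite !mxE.
by rewrite dotZr; lra.
Unshelve. all: by end_near. Qed.

(** * Densities of barycenters *)

Section integral_nonmeasurable.
Local Open Scope ereal_scope.
Context (d : measure_display) (T : measurableType d) (R : realType).
Variable mu : {measure set T -> \bar R}.
Implicit Types (D N : set T) (f g : T -> \bar R).

Lemma le_integral_nonmeasurable D f g : (forall x, D x -> 0 <= f x) ->
    (forall x, D x -> f x <= g x) ->
  \int[mu]_(x in D) f x <= \int[mu]_(x in D) g x.
Proof.
move=> f0 fg; rewrite !ge0_integralE// => [|x Dx]; last first.
  exact: le_trans (f0 _ Dx) (fg _ Dx).
apply: le_ereal_sup => _ [h /= hf <-]; exists h => // x.
by apply: le_trans (hf x) _; apply: lee_restrict.
Qed.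

Lemma ge0_integral_eq_off_null D N f g : measurable D -> measurable N ->
    mu N = 0 -> measurable_fun D g ->
    (forall x, 0 <= f x) -> (forall x, 0 <= g x) ->
    (forall x, ~ N x -> f x = g x) ->
  \int[mu]_(x in D) f x = \int[mu]_(x in D) g x.
Proof.
move=> mD mN N0 mg f0 g0 fg; apply/eqP; rewrite eq_le; apply/andP; split.
- pose G := g \+ (cst +oo \_ N).
  have Goff x : (D `\` N) x -> G x = g x.
    by case=> _ Nx; rewrite /G/= patchE memNset// adde0.
  have mG : measurable_fun D G.
    apply: emeasurable_funD => //; apply/measurable_funTS.
    by apply/(measurable_restrictT _ mN).
  have G0 x : 0 <= G x by rewrite adde_ge0// erestrict_ge0// => ? _; exact: leey.
  apply: (@le_trans _ _ (\int[mu]_(x in D) G x)).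
    apply: le_integral_nonmeasurable => // x Dx.
    have [Nx|Nx] := pselect (N x); last by rewrite fg// Goff.
    by rewrite /G/= patchE mem_set// addey ?leey// gt_eqF// (lt_le_trans _ (g0 x)).
  rewrite (ge0_negligible_integral mN)// [leRHS](ge0_negligible_integral mN)//.
  by rewrite (eq_integral g)// => x; rewrite inE => /Goff.
- rewrite (ge0_negligible_integral mN)//.
  rewrite (eq_integral f) => [|x]; last by rewrite inE => -[_ /fg ->].
  rewrite integral_mkcond [leRHS]integral_mkcond.
  apply: le_integral_nonmeasurable => x _; first by apply: erestrict_ge0.
  rewrite !patchE; case: ifPn => [|_].
    by rewrite inE => -[Dx _]; rewrite mem_set.
  by case: ifPn.
Qed.

Lemma ae_eq_integral_nonmeasurable D f g : measurable D ->
    measurable_fun D g -> {ae mu, forall x, f x = g x} ->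
  \int[mu]_(x in D) f x = \int[mu]_(x in D) g x.
Proof.
move=> mD mg [N [mN N0 fgN]].
have fg x : ~ N x -> f x = g x by move=> Nx; apply: contrapT => /fgN.
rewrite integralE [RHS]integralE; congr (_ - _);
  apply: (ge0_integral_eq_off_null mD mN N0) => //.
- exact: measurable_funepos.
- by move=> x Nx; rewrite !funeposE fg.
- exact: measurable_funeneg.
- by move=> x Nx; rewrite !funenegE fg.
Qed.

End integral_nonmeasurable.

Section density.
Context (d : measure_display) (T : measurableType d) (R : realType).
Implicit Types (sigma nu : {finite_measure set T -> \bar R}) (r f : T -> R).

Definition density sigma nu r :=
  [/\ measurable_fun setT r, forall x, 0 <= r x &
    forall A, measurable A -> nu A = (\int[sigma]_(x in A) (r x)%:E)%E].

Lemma density_exists sigma nu : nu `<< sigma -> exists r, density sigma nu r.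
Proof.
move=> /radon_nikodym_sigma_finite[f [f0 ffin fi fE]].
exists (fine \o f); split.
- apply/measurable_EFinP; rewrite (_ : EFin \o _ = f); last first.
    by apply/funext => x; rewrite /= fineK.
  exact: measurable_int fi.
- by move=> x; rewrite /= fine_ge0.
- by move=> A mA; rewrite fE//; apply: eq_integral => x _; rewrite /= fineK.
Qed.

Section density_theory.
Variables (sigma nu : {finite_measure set T -> \bar R}) (r : T -> R).
Hypothesis dr : density sigma nu r.

Let mr : measurable_fun setT (EFin \o r).
Proof. by apply/measurable_EFinP; case: dr. Qed.

Lemma density_dominates : nu `<< sigma.
Proof.
apply/null_content_dominatesP => A mA A0; case: dr => _ _ ->//.
by apply: null_set_integral => //; exact: measurable_funTS.
Qed.

Let RN := Radon_Nikodym (charge_of_finite_measure nu) sigma.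

Let RN_dominates : charge_of_finite_measure nu `<< sigma.
Proof. exact: density_dominates. Qed.

Let aeRN A : measurable A -> ae_eq sigma A RN (EFin \o r).
Proof.
move=> mA; apply: integral_ae_eq => //.
- apply: (integrableS measurableT) => //; exact: Radon_Nikodym_integrable.
- exact: measurable_funTS.
- move=> E _ mE; rewrite /RN -Radon_Nikodym_integral//.
  by have [_ _ rE] := dr; exact: rE.
Qed.

Lemma density_integral f A : measurable A ->
    nu.-integrable setT (EFin \o f) ->
  (\int[sigma]_(x in A) (f x * r x)%:E = \int[nu]_(x in A) (f x)%:E)%E.
Proof.
move=> mA fi.
have fA : nu.-integrable A (EFin \o f) by exact: integrableS fi.
rewrite -(Radon_Nikodym_change_of_variables density_dominates)//.
have mf : measurable_fun A (EFin \o f) by exact: measurable_int fA.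
apply: ae_eq_integral => //.
- under eq_fun do rewrite EFinM.
  by apply: emeasurable_funM => //; exact: measurable_funTS.
- apply: emeasurable_funM => //; apply: measurable_funTS.
  exact: measurable_int (Radon_Nikodym_integrable RN_dominates).
- by apply: filterS (aeRN mA) => x /[apply] rx; rewrite EFinM -[(r x)%:E]rx.
Qed.

Lemma density_integrable f : nu.-integrable setT (EFin \o f) ->
  sigma.-integrable setT (EFin \o (fun x => f x * r x)).
Proof.
move=> fi; have mf := measurable_int _ fi; apply/integrableP; split.
  by apply/measurable_EFinP; apply: measurable_funM; exact/measurable_EFinP.
have r0 : forall x, 0 <= r x by case: dr.
under eq_integral do rewrite /= normrM (ger0_norm (r0 _)).
by rewrite (@density_integral (fun x => `|f x|))//;
  [case/integrableP : fi|exact: integrable_norm].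
Qed.

Lemma ae_of_density (P : T -> Prop) : {ae nu, forall x, P x} ->
  {ae sigma, forall x, r x != 0 -> P x}.
Proof.
have [mr' r0 rE] := dr.
move=> [N [mN N0 PN]].
have : ae_eq sigma N (EFin \o r) (cst 0%E).
  apply/ae_eq_integral_abs => //; first exact: measurable_funTS.
  under eq_integral do rewrite /= (ger0_norm (r0 _)).
  by rewrite -rE.
apply: filterS => x H rx; apply: contrapT => /PN /H /= [rx0].
by rewrite rx0 eqxx in rx.
Qed.

Lemma density_ae (P : T -> Prop) : {ae sigma, forall x, r x != 0 -> P x} ->
  {ae nu, forall x, r x != 0 /\ P x}.
Proof.
have [mr' r0 rE] := dr => -[N [mN N0 PN]].
pose Z := r @^-1` [set 0].
have mZ : measurable Z by rewrite -[Z]setTI; exact: mr'.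
have nuN : nu N = 0%E by have /null_content_dominatesP := density_dominates; exact.
have nuZ : nu Z = 0%E.
  rewrite rE// (eq_integral (cst 0%E)) ?integral0// => x.
  by rewrite inE /Z /= => ->.
apply: (@negligibleS _ _ _ _ (N `|` Z)).
  move=> x /= /not_andP[/negP|nP]; first by rewrite negbK => /eqP; right.
  have [rx|rx] := eqVneq (r x) 0; first by right.
  by left; apply: PN => /(_ rx).
by apply: negligibleU; apply/negligibleP.
Qed.

End density_theory.

(* beta, restricted to the complement of a ref-null set, has density
   a f + c b g as well as u s with respect to sigma. *)
Lemma RN_density_density (sigma L K ref : {finite_measure set T -> \bar R})
    (f g s a b u : T -> R) (c : R) (beta : set T -> R) :
    density sigma L f -> density sigma K g -> density sigma ref s ->
    completion_integrable L a -> (c != 0 -> completion_integrable K b) ->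
    (forall V, measurable V ->
      beta V = \int[L]_(x in V) a x + c * \int[K]_(x in V) b x) ->
    is_RN_density ref beta u ->
  {ae sigma, forall x, s x != 0 -> u x * s x = a x * f x + c * (b x * g x)}.
Proof.
move=> df dg ds [a' ia' aa'] cb betaE [iu [sg [M [mM M0 sgM]] betaRN]].
have [b' ib' bb'] : exists2 b', K.-integrable setT (EFin \o b') &
    c != 0 -> {ae K, forall x, b x = b' x}.
  have [_|c0] := eqVneq c 0.
    by exists (cst 0) => //; exact: integrable0.
  by have [b' ? ?] := cb c0; exists b'.
have Rint_ae (mu : {finite_measure set T -> \bar R}) k k' V :
    measurable V -> mu.-integrable setT (EFin \o k') ->
    {ae mu, forall x, k x = k' x} ->
    \int[mu]_(x in V) k x = \int[mu]_(x in V) k' x.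
  move=> mV ik' kk'; congr fine; apply: ae_eq_integral_nonmeasurable => //.
    by apply: measurable_funTS; exact: measurable_int ik'.
  by apply: filterS kk' => x ->.
have betaE' V : measurable V ->
    beta V = \int[sigma]_(x in V) (a' x * f x + c * (b' x * g x)).
  move=> mV; rewrite betaE// (Rint_ae _ _ _ _ mV ia' aa').
  have iaf := integrableS measurableT mV (@subsetT _ V) (density_integrable df ia').
  have ibg := integrableS measurableT mV (@subsetT _ V) (density_integrable dg ib').
  rewrite RintegralD//; last exact: (integrableZl mV c ibg).
  rewrite RintegralZl//.
  congr (_ + _); first by rewrite /Rintegral (density_integral df).
  have [->|c0] := eqVneq c 0; first by rewrite !mul0r.
  congr (_ * _); rewrite (Rint_ae _ _ _ _ mV ib' (bb' c0)).
  by rewrite /Rintegral (density_integral dg).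
have iaf := density_integrable df ia'; have ibg := density_integrable dg ib'.
have ius := density_integrable ds iu.
have iv : sigma.-integrable setT
    (EFin \o (fun x => a' x * f x + c * (b' x * g x))).
  exact: (integrableD measurableT iaf (integrableZl measurableT c ibg)).
have mCM := measurableC mM.
have aeM : ae_eq sigma (~` M) (EFin \o (fun x => u x * s x))
    (EFin \o (fun x => a' x * f x + c * (b' x * g x))).
  apply: integral_ae_eq => //.
  - exact: integrableS ius.
  - by apply: measurable_funTS; exact: measurable_int iv.
  - move=> E EM mE; rewrite /= (density_integral ds)//.
    have := betaRN E mE; rewrite sgM// adde0 => <-; rewrite betaE'//.
    rewrite /Rintegral fineK//; apply: integrable_fin_num => //.
    exact: integrableS iv.
have sM : {ae sigma, forall x, s x != 0 -> ~ M x}.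
  by apply: (ae_of_density ds); exists M; split => // x /contrapT.
have fa := ae_of_density df aa'.
have gb : {ae sigma, forall x, g x != 0 -> c != 0 -> b x = b' x}.
  have [_|c0] := eqVneq c 0; first by apply: aeW => x _.
  by apply: filterS (ae_of_density dg (bb' c0)) => x H gx _; exact: H.
apply: filterS3 aeM (filterI sM fa) gb => x aex [sx fx] gx s0.
have [->] := aex (sx s0); congr (_ + _).
  by have [->|f0] := eqVneq (f x) 0; rewrite ?mulr0// fx.
have [->|c0] := eqVneq c 0; first by rewrite !mul0r.
by have [->|g0] := eqVneq (g x) 0; rewrite ?mulr0// gx.
Qed.

End density.

Section finite_measure_add.
Context (d : measure_display) (T : measurableType d) (R : realType).
Variables m1 m2 : {finite_measure set T -> \bar R}.

Let measure_add_fin : fin_num_fun (measure_add m1 m2).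
Proof.
by move=> A mA; rewrite measure_addE fin_numD !fin_num_measure.
Qed.

HB.instance Definition _ := Measure.on (measure_add m1 m2).
HB.instance Definition _ :=
  Measure_isFinite.Build _ _ _ (measure_add m1 m2) measure_add_fin.

Lemma measure_add_dominatesl : m1 `<< measure_add m1 m2.
Proof.
apply/null_content_dominatesP => A mA A0.
have /eqP : (m1 A + m2 A = 0)%E by rewrite -measure_addE.
by rewrite padde_eq0// => /andP[/eqP].
Qed.

Lemma measure_add_dominatesr : m2 `<< measure_add m1 m2.
Proof.
apply/null_content_dominatesP => A mA A0.
have /eqP : (m1 A + m2 A = 0)%E by rewrite -measure_addE.
by rewrite padde_eq0// => /andP[_ /eqP].
Qed.

End finite_measure_add.

Lemma lebesgue_rV_unit_cube (R : realType) n :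
  lebesgue_rV n (@unit_cube R n) = 1%E.
Proof.
elim: n => [|n IH].
  by rewrite /= diracE mem_set// => -[].
rewrite /= /lebesgue_cons /pushforward (_ : _ @^-1` _ =
    `[0, 1[%classic `*` @unit_cube R n); last first.
  apply/seteqP; split=> [[x v] /= cx|[x v] /= [x01 cv] i].
    split=> [|i]; rewrite /= ?in_itv/=.
      by have := cx ord0; rewrite mxE unlift_none.
    by have := cx (lift ord0 i); rewrite mxE liftK.
  rewrite mxE; case: unliftP => [j _|_]; first exact: cv.
  by move: x01; rewrite /= in_itv.
rewrite product_measure1E//; last exact: measurable_unit_cube.
rewrite [X in (_ * X)%E]IH mule1 [LHS]lebesgue_measure_itv/=.
by rewrite lte_fin ltr01 oppr0 adde0.
Qed.

Section finite_lebesgue_torus.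
Variables (R : realType) (d : nat).

Let lebesgue_torus_fin : fin_num_fun (lebesgue_torus R d).
Proof.
apply: lty_fin_num_fun; rewrite /= /lebesgue_torus /pushforward preimage_setT.
by rewrite /mrestr setTI [ltLHS]lebesgue_rV_unit_cube ltry.
Qed.

HB.instance Definition _ :=
  Measure_isFinite.Build _ _ _ (lebesgue_torus R d) lebesgue_torus_fin.
End finite_lebesgue_torus.

(** * Recession functions of class R2 *)

Lemma cvg_limf_esup_einf (R : realType) (U : choiceType)
    (T : filteredType U) (F : set_system T) (q : T -> R) (l : R) : Filter F ->
    limf_esup (EFin \o q) F = l%:E -> limf_einf (EFin \o q) F = l%:E ->
  q @ F --> l.
Proof.
move=> FF; rewrite limf_esupE limf_einfE => sl il.
apply/cvgrPdist_lt => e e0.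
have : (ereal_inf [set ereal_sup ((EFin \o q) @` V) | V in F] < (l + e)%:E)%E.
  by rewrite sl lte_fin ltrDl.
move=> /ereal_inf_lt[_ [V FV <-] Vl].
have : ((l - e)%:E < ereal_sup [set ereal_inf ((EFin \o q) @` V) | V in F])%E.
  by rewrite il lte_fin ltrBlDr ltrDl.
move=> /ereal_sup_gt[_ [W FW <-] Wl].
apply: filterS2 FV FW => x Vx Wx.
have : ((q x)%:E < (l + e)%:E)%E.
  by apply: le_lt_trans Vl; apply: ereal_sup_ubound; exists x.
have : ((l - e)%:E < (q x)%:E)%E.
  by apply: lt_le_trans Wl _; apply: ereal_inf_lbound; exists x.
by rewrite !lte_fin ltr_distlC => -> ->.
Qed.

Section recession_R2.
Variables (R : realType) (d m : nat) (Omega : set 'rV[R]_d).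
Variable h : torus R d -> 'rV[R]_m -> R.
Hypothesis h_R2 : R2 Omega (fun=> h).
Let G := recession Omega (fun=> h).

Lemma recession_cvg x xi z : closure Omega x ->
  h p.1 (p.2 *: z) / p.2 @[p --> filter_prod (nbhs xi) (pinfty_nbhs R)]
    --> G x xi z.
Proof.
move=> cx; have [_ /(_ x xi z cx)[us ls]] := h_R2.
have FF : Filter (recession_filter Omega x xi).
  by rewrite /recession_filter; typeclasses eauto.
move=> U nU.
have [[A B] /= [[[A1 A2] /= [A1n A2n] A12] Bn] AB] :=
  cvg_limf_esup_einf FF us ls nU.
have [y [/= Oy /(_ Oy) A1y]] := cx _ A1n.
exists (A2, B) => // -[xi' t] [/= A2xi Bt].
by apply: (AB (y, xi', t)); split=> //=; exact: (A12 (y, xi')).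
Qed.

Lemma recession_limit_R2 x xi : closure Omega x ->
  recession_limit (h xi) (G x xi).
Proof.
move=> cx z U nU; have [[A B] /= [An Bn] AB] := recession_cvg cx nU.
apply: filterS Bn => t Bt; apply: (AB (xi, t)); split => //.
exact: nbhs_singleton.
Qed.

Lemma recession_recession x : closure Omega x ->
  recession Omega G x = G x.
Proof.
move=> cx; apply/funext => xi; apply/funext => z.
apply: cvg_lim => //; apply/cvgrPdist_le => e e0.
have /cvgrPdist_le/(_ e e0)[[A B] /= [An Bn] AB] := @recession_cvg x xi z cx.
exists ([set q | Omega q.1 /\ A q.2], [set t | 0 < t]).
  split; last exact: nbhs_pinfty_gt.
  exists (Omega, A); last by [].
  by split => //=; exact: withinT.
move=> [[x' xi'] t] [/= [Ox' Axi'] t0].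
have lim' := recession_limit_R2 (xi := xi') (subset_closure Ox').
rewrite /recession_quotient/= (recession_homogeneous lim')// mulrAC mulfV ?gt_eqF//.
rewrite mul1r; have limd : `|G x xi z - h xi' (s *: z) / s| @[s --> +oo] -->
    `|G x xi z - G x' xi' z|.
  by apply: cvg_norm; apply: cvgB; [exact: cvg_cst|exact: lim'].
apply: (cvgr_to_le limd); apply: filterS Bn => s Bs.
by apply: (AB (xi', s)).
Qed.

End recession_R2.

Theorem proposition6p2 (R : realType) (d m l k : nat) (p : R)
    (Omega : set 'rV[R]_d)
    (A : {ffun 'I_d -> 'I_k.+1} -> 'Hom('rV[R]_m, 'rV[R]_l))
    (nu : young2 m Omega) (h : torus R d -> 'rV[R]_m -> R)
    (d_gt0 : (0 < d)%N) (Omega_open : open Omega)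
    (Omega_bounded : bounded_set Omega)
    (Omega_boundary : lebesgue_rV d (closure Omega `\` Omega) = 0%E)
    (p_gt1 : 1 < p) (p_lt : p * (d%:R - 1) < d%:R)
    (nu_free : A_free A p nu)
    (h_cont : continuous (fun q : torus R d * 'rV[R]_m => h q.1 q.2))
    (h_R2 : R2 Omega (fun=> h))
    (h_convex : forall xi, convex_function [set: convex_lmodType 'rV[R]_m] (h xi))
    (lambda_ac : 'rV[R]_d -> R)
    (lambda_s : {finite_measure set 'rV[R]_d -> \bar R})
    (lambda_dec :
      lebesgue_decomposition (conc nu) (lebesgue_rV d) lambda_ac lambda_s)
    (x : 'rV[R]_d) (x_reg : regular_point Omega lambda_s x)
    (id_def : id_barycenter_defined lambda_ac nu x) :
  let H : 'rV[R]_d -> torus R d -> 'rV[R]_m -> R := fun=> h in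
  let Hinf := recession Omega H in
  (fun_barycenter_defined lambda_ac nu x H ->
    forall (u : torus R d -> 'rV[R]_m) (w : torus R d -> R),
    (forall i, is_RN_density (lebesgue_torus R d)
                 (id_barycenter lambda_ac nu x i) (fun xi => u xi 0 i)) ->
    is_RN_density (lebesgue_torus R d) (fun_barycenter lambda_ac nu x H) w ->
    {ae lebesgue_torus R d, forall xi, h xi (u xi) <= w xi}) /\
  (fun_barycenter_defined lambda_ac nu x Hinf ->
    forall (rho_ac : torus R d -> R)
      (rho_s : {finite_measure set (torus R d) -> \bar R}),
    lebesgue_decomposition (conc_scale nu x) (lebesgue_torus R d) rho_ac rho_s ->
    forall (u : torus R d -> 'rV[R]_m) (w : torus R d -> R),
    (forall i, is_RN_density rho_s
                 (id_barycenter lambda_ac nu x i) (fun xi => u xi 0 i)) ->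
    is_RN_density rho_s (fun_barycenter lambda_ac nu x Hinf) w ->
    {ae rho_s, forall xi, Hinf x xi (u xi) <= w xi}).
Proof.
move=> H Hinf; have cx : closure Omega x by case: x_reg.
have ch xi : convex_fun (h xi) by exact: convex_function_fun.
have mh xi : measurable_fun setT (h xi).
  apply: continuous_measurable_mx => z.
  apply: (@continuous_comp _ _ _ (pair xi) (fun q : torus R d * _ => h q.1 q.2)).
    move=> U [[A1 A2] /= [xiA1 zA2] A12]; apply: filterS zA2 => y A2y.
    by apply: A12; split => //; exact: nbhs_singleton.
  exact: h_cont.
have hG xi : recession_limit (h xi) (Hinf x xi).
  exact: (recession_limit_R2 h_R2).
have sphere1 xi := conc_dir_sphere nu xi cx.
have lam0 : 0 <= lambda_ac x by case: lambda_dec.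
pose L : {finite_measure set (torus R d) -> \bar R} := lebesgue_torus R d.
pose K : {finite_measure set (torus R d) -> \bar R} := conc_scale nu x.
pose sigma : {finite_measure set (torus R d) -> \bar R} := measure_add L K.
have [f df] := density_exists (@measure_add_dominatesl _ _ _ L K : L `<< sigma).
have [g dg] := density_exists (@measure_add_dominatesr _ _ _ L K : K `<< sigma).
have [[_ f0 _] [_ g0 _]] := (df, dg).
split=> [[ih aeh ieh] u w uD wD|[_ aeh ieh] rho_ac rho_s rhoD u w uD wD].
- have aeu : {ae sigma, forall xi, forall i, f xi != 0 -> u xi 0 i * f xi =
      \int[osc nu x xi]_z (z : 'rV[R]_m) 0 i * f xi + lambda_ac x *
      (\int[conc_dir nu x xi]_(z in unit_sphere) (z : 'rV[R]_m) 0 i * g xi)}.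
    apply: filter_forall => i; have [_ ai ci] := id_def i.
    exact: (RN_density_density df dg df ai ci _ (uD i)).
  have aew := RN_density_density df dg df aeh ieh (fun _ _ => erefl) wD.
  have aei : {ae L, forall xi i,
      (osc nu x xi).-integrable setT (EFin \o @Defs.coord R d m i xi)}.
    by apply: filter_forall => i; have [] := id_def i.
  have : {ae L, forall xi, f xi != 0 /\ ((forall i, u xi 0 i * f xi =
      \int[osc nu x xi]_z (z : 'rV[R]_m) 0 i * f xi + lambda_ac x *
      (\int[conc_dir nu x xi]_(z in unit_sphere) (z : 'rV[R]_m) 0 i * g xi)) /\
      w xi * f xi = \int[osc nu x xi]_z h xi z * f xi + lambda_ac x *
      (\int[conc_dir nu x xi]_(z in unit_sphere) Hinf x xi z * g xi))}.
    apply: (density_ae df); apply: filterS2 aeu aew => xi uE wE fxi.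
    by split=> [i|]; [exact: uE|exact: wE].
  apply: filterS3 ih aei => xi ihxi ii [fxi [uE wE]].
  have s0 : 0 <= lambda_ac x * (g xi / f xi) by rewrite mulr_ge0// divr_ge0.
  have := jensen_recession (ch xi) (hG xi) (sphere1 xi) ii ihxi s0.
  set v := \row_i _; have -> : v = u xi.
    apply/rowP => i; rewrite mxE; apply: (mulIf fxi); rewrite uE; field.
    exact: fxi.
  suff -> : w xi = \int[osc nu x xi]_z h xi z + lambda_ac x * (g xi / f xi) *
      \int[conc_dir nu x xi]_(z in unit_sphere) Hinf x xi z by [].
  by apply: (mulIf fxi); rewrite wE; field; exact: fxi.
- have rhoK : rho_s `<< K.
    apply/null_content_dominatesP => V mV KV.
    have [_ rho0 _ /(_ V mV)] := rhoD; rewrite [LHS]KV => /esym/eqP.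
    rewrite padde_eq0//; first by move=> /andP[_ /eqP].
    by apply: integral_ge0 => xi _; rewrite lee_fin.
  have [s ds] : exists s, density sigma rho_s s.
    apply: density_exists; apply: null_dominates_trans rhoK _.
    exact: measure_add_dominatesr.
  have [_ s0 _] := ds.
  have aeu : {ae sigma, forall xi, forall i, s xi != 0 -> u xi 0 i * s xi =
      \int[osc nu x xi]_z (z : 'rV[R]_m) 0 i * f xi + lambda_ac x *
      (\int[conc_dir nu x xi]_(z in unit_sphere) (z : 'rV[R]_m) 0 i * g xi)}.
    apply: filter_forall => i; have [_ ai ci] := id_def i.
    exact: (RN_density_density df dg ds ai ci _ (uD i)).
  have aew := RN_density_density df dg ds aeh ieh (fun _ _ => erefl) wD.
  have [_ _ [N [mN LN rhoN]] _] := rhoD.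
  have fN : {ae sigma, forall xi, f xi != 0 -> ~ N xi}.
    by apply: (ae_of_density df); exists N; split => // xi /contrapT.
  have sN : {ae sigma, forall xi, s xi != 0 -> N xi}.
    apply: (ae_of_density ds); exists (~` N); split => //.
      exact: measurableC.
    by apply: rhoN => //; exact: measurableC.
  have : {ae rho_s, forall xi, s xi != 0 /\ ((forall i, u xi 0 i * s xi =
      lambda_ac x *
      (\int[conc_dir nu x xi]_(z in unit_sphere) (z : 'rV[R]_m) 0 i * g xi)) /\
      w xi * s xi = lambda_ac x *
      (\int[conc_dir nu x xi]_(z in unit_sphere) Hinf x xi z * g xi))}.
    apply: (density_ae ds).
    apply: filterS3 aeu aew (filterI fN sN) => xi uE wE [fx sx] sxi.
    have fxi : f xi = 0.
      by apply/eqP; apply: contrapT => /negP/fx; apply; exact: sx.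
    split=> [i|]; first by rewrite uE// fxi mulr0 add0r.
    rewrite wE// fxi mulr0 add0r.
    by rewrite (recession_recession h_R2 cx).
  apply: filterS => xi [sxi [uE wE]].
  have c0 : 0 <= lambda_ac x * (g xi / s xi) by rewrite mulr_ge0// divr_ge0.
  have := jensen_recession0 (ch xi) (mh xi) (hG xi) (sphere1 xi) c0.
  set v := \row_i _; have -> : v = u xi.
    apply/rowP => i; rewrite mxE; apply: (mulIf sxi); rewrite uE; field.
    exact: sxi.
  suff -> : w xi = lambda_ac x * (g xi / s xi) *
      \int[conc_dir nu x xi]_(z in unit_sphere) Hinf x xi z by [].
  by apply: (mulIf sxi); rewrite wE; field; exact: sxi.
Qed.
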